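(* If $G$ is a graph in $1$-$HNG$, then $\chi(G)\le \omega(G)+1$.
   Context: All graphs are finite, simple, and have at least one vertex; induced subgraphs are taken on nonempty vertex sets. $\chi(G)$ is the chromatic number, $\omega(G)$ the clique number, and $\theta(G)=\chi(\overline{G})$ the clique cover number. A graph $G$ is in the class $1$-$HNG$ if every induced subgraph $H$ of $G$ (including $G$ itself) satisfies $\chi(H)+\theta(H)\ge |V(H)|$. *)

(* Defs.v *)
From mathcomp Require Import all_boot.
Set Implicit Arguments.
Unset Strict Implicit.
Unset Printing Implicit Defensive.

Record sgraph := SGraph {
  svertex :> finType;
  sedge : rel svertex;
  sedge_sym : symmetric sedge;
  sedge_irrefl : irreflexive sedge
}.

Section Constructions.
Variable G : sgraph.

Definition compl_edge : rel G := [rel x y | (x != y) && ~~ sedge x y].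

Lemma compl_edge_sym : symmetric compl_edge.
Proof. by move=> x y; rewrite /compl_edge /= eq_sym sedge_sym. Qed.

Lemma compl_edge_irrefl : irreflexive compl_edge.
Proof. by move=> x; rewrite /compl_edge /= eqxx. Qed.

Definition compl_graph : sgraph := SGraph compl_edge_sym compl_edge_irrefl.

Variable S : {set G}.

Definition induced_edge : rel {x : G | x \in S} :=
  [rel u v | sedge (val u) (val v)].

Lemma induced_edge_sym : symmetric induced_edge.
Proof. by move=> u v; apply: sedge_sym. Qed.

Lemma induced_edge_irrefl : irreflexive induced_edge.
Proof. by move=> u; apply: sedge_irrefl. Qed.

Definition induced : sgraph := SGraph induced_edge_sym induced_edge_irrefl.

End Constructions.

Definition proper_coloring (G : sgraph) (k : nat) (f : {ffun G -> 'I_k}) : bool :=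
  [forall x, forall y, sedge x y ==> (f x != f y)].

Definition colorable (G : sgraph) (k : nat) : bool :=
  [exists f : {ffun G -> 'I_k}, proper_coloring f].

Lemma colorable_exists (G : sgraph) : exists k, colorable G k.
Proof.
exists #|G|; apply/existsP; exists [ffun x => enum_rank x].
apply/forallP=> x; apply/forallP=> y; apply/implyP=> exy.
rewrite !ffunE; apply: contraTneq exy => /enum_rank_inj ->.
by rewrite sedge_irrefl.
Qed.

Definition chromatic_number (G : sgraph) : nat := ex_minn (colorable_exists G).

Definition clique (G : sgraph) (A : {set G}) : bool :=
  [forall x in A, forall y in A, (x != y) ==> sedge x y].

Definition clique_number (G : sgraph) : nat :=
  \max_(A : {set G} | clique A) #|A|.

Definition clique_cover_number (G : sgraph) : nat :=
  chromatic_number (compl_graph G).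

Definition one_HNG (G : sgraph) : Prop :=
  forall S : {set G}, S != set0 ->
    #|induced S| <=
      chromatic_number (induced S) + clique_cover_number (induced S).

(* Main.v *)
(* In a 1-HNG graph, a set covered by m cliques and by k stable sets has at most m + k
   vertices. By induction on vertex sets S we show that if the cliques in S have at most
   w vertices, then S is (w+1)-colourable; one may delete a vertex common to all w-cliques,
   so assume that every vertex is avoided by some w-clique, and w >= 3 (w = 2 is treated
   separately). Two w-cliques K, L satisfy |K - L| <= 2, because by Hall's theorem their
   symmetric difference is |K - L|-colourable, and it is covered by two cliques. This
   forces the existence of a "central" K with |K - L| <= 1 for every w-clique L. Let E be
   the vertices outside K that miss exactly one vertex of K, F the other outer vertices
   with a neighbour in E, and R the rest. Then E + R is stable, and F is stable and
   anticomplete to K (F is empty unless w = 3), so w + 1 colours suffice. *)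
Require Import Defs.
From mathcomp Require Import all_boot.
Set Implicit Arguments.
Unset Strict Implicit.
Unset Printing Implicit Defensive.

(** * Hall's marriage theorem *)

Section Hall.
Variables (T : finType) (r : rel T).

Definition joint_nbrs (B X : {set T}) : {set T} := [set y in B | [exists x in X, r x y]].

(* Halmos and Vaughan's induction: split at a tight proper subset of [A] if there is one,
   otherwise match an arbitrary vertex first. *)
Lemma hall (A B : {set T}) :
  (forall X : {set T}, X \subset A -> #|X| <= #|joint_nbrs B X|) ->
  exists f : T -> T, {in A &, injective f} /\ (forall x, x \in A -> f x \in B /\ r x (f x)).
Proof.
have [n] := ubnP #|A|; elim: n => // n IH in A B * => /ltnSE leAn hallA.
have [->|[a aA]] := set_0Vmem A; first by exists id; split=> x; rewrite inE.
have [/existsP[X /and3P[XA X0 /eqP cX]]|tight] :=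
  boolP [exists X : {set T}, [&& X \proper A, X != set0 & #|X| == #|joint_nbrs B X|]].
  have ltXA := proper_card XA; have sXA := proper_sub XA.
  have [|Y YX|f [finj fP]] := IH X B; first exact: leq_trans ltXA _.
    by apply: hallA; exact: subset_trans YX sXA.
  have X_gt0 : 0 < #|X| by rewrite card_gt0.
  have cD := cardsD A X; rewrite (setIidPr sXA) in cD.
  (* Hall's condition survives on the complement of the tight set [X]: apply it to [X :|: Y] and
     subtract the equal sizes of [X] and [joint_nbrs B X]. *)
  have [||g [ginj gP]] := IH (A :\: X) (B :\: joint_nbrs B X).
  - by rewrite cD (leq_trans _ leAn) // ltn_subrL X_gt0 (leq_trans X_gt0 (subset_leq_card sXA)).
  - move=> Y YA; have YX : [disjoint Y & X].
      by rewrite disjoint_sym; move: YA; rewrite subsetD => /andP[_]; rewrite disjoint_sym.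
    have := hallA (X :|: Y); rewrite subUset sXA (subset_trans YA (subsetDl _ _)) => /(_ isT).
    rewrite cardsU disjoint_setI0 1?disjoint_sym // cards0 subn0 => h.
    have sub : joint_nbrs B (X :|: Y) \subset joint_nbrs B X :|: joint_nbrs (B :\: joint_nbrs B X) Y.
      apply/subsetP=> y; rewrite !inE => /andP[yB /existsP[x /andP[]]]; rewrite inE.
      rewrite yB /=; have [//|ny] := boolP [exists x in X, r x y].
      case/orP=> [xX rxy|xY rxy]; first by case/existsP: ny; exists x; rewrite xX.
      by apply/existsP; exists x; rewrite xY.
    have := leq_trans h (leq_trans (subset_leq_card sub) (leq_card_setU _ _)).
    by rewrite cX leq_add2l.
  exists (fun x => if x \in X then f x else g x); split=> [x y xA yA|x xA]; last first.
    case: ifPn => xX; first exact: fP.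
    by have [|] := gP x; [rewrite inE xX|rewrite inE => /andP[_ ->]].
  have diff u v : u \in A -> v \in A -> u \in X -> v \notin X -> f u <> g v.
    move=> uA vA uX vX efg; have [|] := gP v; first by rewrite inE vX.
    rewrite -efg inE => /andP[/negP[]]; rewrite inE.
    by have [-> ru] := fP u uX; apply/existsP; exists u; rewrite uX.
  case: ifPn => xX; case: ifPn => yX e.
  - exact: finj.
  - by case: (diff x y).
  - by case: (diff y x).
  - by apply: ginj => //; rewrite inE ?xX ?yX.
have [b bB rab] : exists2 b, b \in B & r a b.
  have := hallA [set a]; rewrite sub1set cards1 => /(_ aA) /card_gt0P[b].
  by rewrite inE => /andP[bB /existsP[x /andP[/set1P ->]]]; exists b.
(* With no tight set, every nonempty proper subset of [A] has a neighbour to spare, so losing [b]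
   does no harm. *)
have [||f [finj fP]] := IH (A :\ a) (B :\ b).
- by rewrite (cardsD1 a) aA in leAn.
- move=> X XA; have [->|X0] := eqVneq X set0; first by rewrite cards0.
  have XpA : X \proper A.
    by rewrite properE (subset_trans XA (subsetDl _ _)); apply: contraL XA => /subsetP/(_ a aA) aX;
       apply/negP=> /subsetP/(_ a aX); rewrite !inE eqxx.
  have ltX : #|X| < #|joint_nbrs B X|.
    rewrite ltn_neqAle hallA ?proper_sub // andbT.
    by apply: contraNneq tight => e; apply/existsP; exists X; rewrite XpA X0 e eqxx.
  have sub : joint_nbrs B X :\ b \subset joint_nbrs (B :\ b) X.
    by apply/subsetP=> y; rewrite !inE andbA.
  apply: leq_trans (subset_leq_card sub); move: ltX; rewrite [#|joint_nbrs B X|](cardsD1 b).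
  by case: (b \in _); rewrite ?add1n ?add0n ?ltnS //; exact: ltnW.
exists (fun x => if x == a then b else f x); split=> [x y xA yA|x xA]; last first.
  case: eqVneq => [->//|xa]; have [|] := fP x; first by rewrite !inE xa.
  by rewrite inE => /andP[_ ->].
have fb u : u \in A -> u != a -> f u != b.
  by move=> uA ua; have [|] := fP u; [rewrite !inE ua|rewrite !inE => /andP[]].
case: eqVneq => [->|xa]; case: eqVneq => [->|ya] // e.
- by have := fb y yA ya; rewrite -e eqxx.
- by have := fb x xA xa; rewrite e eqxx.
- by apply: finj => //; rewrite !inE ?xa ?ya.
Qed.
End Hall.

(** * Colourings, cliques and the 1-HNG inequality *)

Lemma chromatic_number_le (G : sgraph) k (f : G -> nat) :
  (forall x, f x < k) -> (forall x y, sedge x y -> f x != f y) -> chromatic_number G <= k.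
Proof.
move=> fk fP; rewrite /chromatic_number; case: ex_minnP => m _; apply.
apply/existsP; exists [ffun x => Ordinal (fk x)].
apply/forallP=> x; apply/forallP=> y; apply/implyP=> /fP.
by rewrite !ffunE.
Qed.

Lemma cliqueP (G : sgraph) (A : {set G}) :
  reflect {in A &, forall x y, x != y -> sedge x y} (clique A).
Proof.
apply: (iffP forall_inP) => [h x y xA yA xy|h x xA].
  by have /forall_inP/(_ y yA)/implyP/(_ xy) := h x xA.
by apply/forall_inP=> y yA; apply/implyP; exact: h.
Qed.

Local Notation "x -- y" := (sedge x y) (at level 30).

Lemma exists_notin (T : finType) (A : {set T}) (s : seq T) :
  size s < #|A| -> exists2 x, x \in A & x \notin s.
Proof.
move=> ltsA; apply/subsetPn; apply: contraL ltsA => /subset_leq_card leAs.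
by rewrite -leqNgt (leq_trans leAs) // card_size.
Qed.

Section OneHNG.
Variable G : sgraph.
Hypothesis hngG : one_HNG G.
Implicit Types (S K L : {set G}) (x y u v e : G).

(** The only access to the 1-HNG hypothesis: [f] is a proper colouring of [S], and the fibres of [g]
    on [S] are cliques, so [#|B|] bounds the chromatic number and [#|C|] the clique cover number. *)
Lemma hng_card (T U : finType) (B : {set T}) (C : {set U}) (f : G -> T) (g : G -> U) S :
  {in S, forall x, f x \in B} -> {in S, forall x, g x \in C} ->
  {in S &, forall x y, x -- y -> f x != f y} ->
  {in S &, forall x y, x != y -> g x = g y -> x -- y} ->
  #|S| <= #|B| + #|C|.
Proof.
move=> fB gC fP gP; have [->|S0] := eqVneq S set0; first by rewrite cards0.
have := hngG S0; rewrite card_sig => /leq_trans; apply.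
apply: leq_add.
  apply: (@chromatic_number_le (induced S) _
    (fun u : {x | x \in S} => index (f (val u)) (enum B)))
    => [[x xS]|[x xS] [y yS] exy] /=.
    by rewrite cardE index_mem mem_enum fB.
  apply: contraNneq (fP x y xS yS exy) => /(congr1 (nth (f x) (enum B))).
  by rewrite !nth_index ?mem_enum ?fB // => ->.
apply: (@chromatic_number_le (compl_graph (induced S)) _
    (fun u : {x | x \in S} => index (g (val u)) (enum C)))
    => [[x xS]|[x xS] [y yS] exy] /=.
  by rewrite cardE index_mem mem_enum gC.
case/andP: exy => /= nxy; apply: contraNneq => /(congr1 (nth (g x) (enum C))).
by rewrite !nth_index ?mem_enum ?gC // => /gP; apply.
Qed.


Definition colorable_on S k := exists f : G -> nat,
  {in S, forall x, f x < k} /\ {in S &, forall x y, x -- y -> f x != f y}.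

Lemma adjC x y : x -- y = y -- x. Proof. exact: sedge_sym. Qed.

Lemma adj_neq x y : x -- y -> x != y.
Proof. by apply: contraTneq => ->; rewrite sedge_irrefl. Qed.

Lemma clique_setU1 x K : clique K -> {in K, forall y, x -- y} -> clique (x |: K).
Proof.
move=> /cliqueP cK xK; apply/cliqueP=> u v /setU1P[->|uK] /setU1P[->|vK] //; rewrite ?eqxx //.
- by move=> _; exact: xK.
- by move=> _; rewrite adjC; exact: xK.
- exact: cK.
Qed.

Lemma clique_subset K L : K \subset L -> clique L -> clique K.
Proof. by move=> /subsetP sKL /cliqueP cL; apply/cliqueP=> x y /sKL xL /sKL; exact: cL. Qed.

Lemma clique1 x : clique [set x].
Proof. by apply/cliqueP=> u v /set1P-> /set1P->; rewrite eqxx. Qed.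

Lemma clique2 x y : x -- y -> clique [set x; y].
Proof. by move=> xy; apply: clique_setU1 => [|v /set1P->//]; exact: clique1. Qed.

Lemma clique3 x y z : x -- y -> x -- z -> y -- z -> clique (x |: [set y; z]).
Proof.
by move=> xy xz yz; apply: clique_setU1 => [|v /set2P[]->//]; exact: clique2.
Qed.

Lemma card_clique3 x y z : x -- y -> x -- z -> y -- z -> #|x |: [set y; z]| = 3.
Proof.
by move=> /adj_neq xy /adj_neq xz /adj_neq yz; rewrite cardsU1 cards2 !inE negb_or xy xz yz.
Qed.

(** * Differences of maximum cliques *)

Section BoundedCliques.
Variables (S : {set G}) (w : nat).
Hypothesis cliques_le : forall K, K \subset S -> clique K -> #|K| <= w.

(** The number [w] is only an upper bound, so [S] may have no such clique. *)
Definition max_clique K := [&& K \subset S, clique K & #|K| == w].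

Lemma max_cliqueP K : reflect [/\ {subset K <= S}, clique K & #|K| = w] (max_clique K).
Proof.
apply: (iffP and3P) => [[/subsetP sK cK /eqP]|[sK cK /eqP]] //.
by split=> //; apply/subsetP.
Qed.

Lemma max_clique_nonadj K v : max_clique K -> v \in S -> v \notin K ->
  exists2 x, x \in K & ~~ v -- x.
Proof.
move=> /max_cliqueP[sK cK kK] vS vK; apply/exists_inP; apply: contraT.
rewrite negb_exists_in => /forall_inP h.
have := @cliques_le (v |: K); rewrite cardsU1 vK kK add1n ltnn => H.
suff: false by []. apply: H.
  by rewrite subUset sub1set vS; apply/subsetP.
by apply: clique_setU1 => // y yK; apply/negPn/h.
Qed.

Lemma card_max_cliqueD K L : max_clique K -> max_clique L -> #|K :\: L| = #|L :\: K|.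
Proof.
by move=> /max_cliqueP[_ _ kK] /max_cliqueP[_ _ kL]; rewrite !cardsD setIC kK kL.
Qed.

(** Pairing each vertex of [A = K :\: L] with a non-neighbour in [B = L :\: K] colours [A :|: B]
    with [#|A|] colours; two cliques cover it, so twice [#|A|] is at most [#|A| + 2]. *)
Lemma max_cliqueD_le2 K L : max_clique K -> max_clique L -> #|K :\: L| <= 2.
Proof.
move=> mK mL; have [sK cK kK] := max_cliqueP _ mK; have [sL cL kL] := max_cliqueP _ mL.
set A := K :\: L; set B := L :\: K.
have kAB : #|A| = #|B| by exact: card_max_cliqueD.
(* Hall's condition: [X] and the vertices of [L] outside its non-neighbourhood [N] in [B] form a
   clique, so [#|X| + (w - #|N|)] is at most [w]. *)
have [X XA|m [injm mP]] := @hall G [rel x y | ~~ x -- y] A B.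
  have XK : {subset X <= K} by move=> x /(subsetP XA); rewrite inE => /andP[].
  have XL x : x \in X -> x \notin L by move=> /(subsetP XA); rewrite inE => /andP[].
  set N := joint_nbrs _ B X; set Q := L :\: N.
  have NL : N \subset L by apply/subsetP=> y; rewrite !inE => /andP[/andP[]].
  have cXQ : clique (X :|: Q).
    apply/cliqueP=> u v.
    have XQ x y : x \in X -> y \in Q -> x != y -> x -- y.
      move=> xX; rewrite !inE => /andP[h yL] nxy; apply/negPn/negP => nad.
      have yK : y \notin K.
        by apply: contra nad => yK; move/cliqueP: cK; apply=> //; exact: XK.
      by move: h; rewrite yK yL => /negP[]; apply/existsP; exists x; rewrite xX.
    rewrite !inE => /orP[uX|uQ] /orP[vX|vQ] nuv.
    - by move/cliqueP: cK; apply=> //; exact: XK.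
    - by apply: XQ => //; rewrite !inE.
    - by rewrite adjC XQ // ?inE // eq_sym.
    - by move/cliqueP: cL; apply=> //; [case/andP: uQ|case/andP: vQ].
  have sXQ : X :|: Q \subset S.
    by apply/subsetP=> x; rewrite !inE => /orP[/XK/sK//|/andP[_ /sL]].
  have dXQ : [disjoint X & Q].
    by rewrite disjoint_subset; apply/subsetP=> x xX; rewrite !inE negb_and (XL x xX) orbT.
  have := cliques_le sXQ cXQ; rewrite cardsU disjoint_setI0 // cards0 subn0.
  have := subset_leq_card NL; rewrite cardsD (setIidPr NL) kL => Nw.
  by rewrite addnC -leq_subRL ?leq_subr // subKn.
have mAB : m @: A = B.
  apply/eqP; rewrite eqEcard card_in_imset // kAB leqnn andbT.
  by apply/subsetP=> _ /imsetP[x /mP[mx _] ->].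
(* Matched vertices share a colour; the default of [odflt] is never reached on [A :|: B], as [m]
   maps onto [B]. *)
pose f y := if y \in A then y else odflt y [pick x in A | m x == y].
have fA x : x \in A -> f x = x by rewrite /f => ->.
have fB x : x \in A -> f (m x) = x.
  move=> xA; have /(_ x xA)[mB _] := mP.
  rewrite /f ifN; last by move: mB; rewrite !inE negb_and negbK => /andP[_ ->].
  by case: pickP => [z /andP[zA /eqP /injm -> //]|/(_ x)]; rewrite xA eqxx.
have : #|A :|: B| <= #|A| + #|[set: bool]|.
  have mem x : x \in A :|: B -> x \in A \/ exists2 z, z \in A & x = m z.
    by rewrite inE => /orP[|]; [left|right; apply/imsetP; rewrite mAB].
  apply: (@hng_card _ _ _ _ f (fun x => x \in A)) => [x /mem[xA|[z zA ->]]|//|x y|x y].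
  - by rewrite fA.
  - by rewrite fB.
  - move=> /mem[xA|[z zA ->]] /mem[yA|[t tA ->]] h.
    + by rewrite !fA //; exact: adj_neq.
    + by rewrite fA // fB //; apply: contraTneq h => ->; have [_ /=] := mP t tA.
    + rewrite fB // fA //; rewrite adjC in h; apply: contraTneq h => <-.
      by have [_ /=] := mP z zA.
    + by rewrite !fB //; apply: contraTneq h => ->; rewrite sedge_irrefl.
  - rewrite !inE => xAB yAB nxy.
    case xK : (x \in K) xAB; case xL : (x \in L) => //=;
    case yK : (y \in K) yAB; case yL : (y \in L) => //= _ _ _.
    + by move/cliqueP: cK; apply.
    + by move/cliqueP: cL; apply.
rewrite cardsT card_bool cardsU disjoint_setI0.
  by rewrite cards0 subn0 leq_add2l -kAB.
by rewrite disjoint_subset; apply/subsetP=> x; rewrite !inE => /andP[_ ->].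
Qed.

(** If [L1] and [L2] covered [K], a common vertex of theirs outside [K] would be adjacent to all of
    [K]. Hence [L1 :\: L2] would contain both [K :\: L2] and the two vertices of [L1 :\: K], which
    is too many. *)
Lemma max_cliqueD_meet K L1 L2 : max_clique K -> max_clique L1 -> max_clique L2 ->
  #|K :\: L1| = 2 -> K :\: L2 != set0 -> exists2 x, x \in K & (x \notin L1) && (x \notin L2).
Proof.
move=> mK m1 m2 k1 n2; apply/exists_inP; apply: contraT.
rewrite negb_exists_in => /forall_inP cov.
have {}cov x : x \in K -> (x \in L1) || (x \in L2).
  by move/cov; rewrite negb_and !negbK.
suff: 2 < #|L1 :\: L2| by rewrite ltnNge max_cliqueD_le2.
suff sub : (K :\: L2) :|: (L1 :\: K) \subset L1 :\: L2.
  apply: leq_trans (subset_leq_card sub); rewrite cardsU disjoint_setI0.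
    by rewrite cards0 subn0 -(card_max_cliqueD mK m1) k1 addn2 !ltnS card_gt0.
  by rewrite disjoint_subset; apply/subsetP=> x; rewrite !inE => /andP[_ ->].
apply/subsetP=> e; rewrite !inE => /orP[/andP[eL2 eK]|/andP[eK e1]].
  by rewrite eL2; move: (cov e eK); rewrite (negPf eL2) orbF.
rewrite e1 andbT; apply/negP=> e2.
have [s1 /cliqueP c1 _] := max_cliqueP _ m1; have [_ /cliqueP c2 _] := max_cliqueP _ m2.
have [x xK /negP[]] := max_clique_nonadj mK (s1 e e1) eK.
have nex : e != x by apply: contraNneq eK => ->.
by have /orP[xL|xL] := cov x xK; [apply: c1|apply: c2].
Qed.


Hypothesis avoid : {in S, forall v, exists2 L, max_clique L & v \notin L}.

(* If |K - L1| = 2, every K - L2 meets K - L1; with K - L1 = {x, y} and K - L2 = {x, z},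
   the cliques L1 and L2 share a vertex q outside K, and K - x + q is central. *)
Lemma exists_central_max_clique : 2 < w -> S != set0 ->
  exists2 K, max_clique K & forall L, max_clique L -> #|K :\: L| <= 1.
Proof.
move=> w3 /set0Pn[v0 v0S]; have [K mK _] := avoid v0S.
have [/forallP cK|] := boolP [forall L, max_clique L ==> (#|K :\: L| <= 1)].
  by exists K => // L; apply/implyP.
rewrite negb_forall => /existsP[L1]; rewrite negb_imply -ltnNge => /andP[m1 gt1].
have k1 : #|K :\: L1| = 2 by apply/eqP; rewrite eqn_leq gt1 max_cliqueD_le2.
have [sK cK kK] := max_cliqueP _ mK; have [s1 c1 _] := max_cliqueP _ m1.
have [z zK z1] : exists2 z, z \in K & z \in L1.
  have : 0 < #|K :&: L1| by have := cardsID L1 K; rewrite k1 kK => e; rewrite -(ltn_add2r 2) e.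
  by case/card_gt0P=> z; rewrite inE => /andP[]; exists z.
have [L2 m2 z2] := avoid (sK z zK); have [s2 c2 _] := max_cliqueP _ m2.
have [|x xK /andP[x1 x2]] := max_cliqueD_meet mK m1 m2 k1.
  by apply/set0Pn; exists z; rewrite inE zK z2.
have nzx : z != x by apply: contraNneq x1 => <-.
have eD2 : K :\: L2 = [set x; z].
  apply/esym/eqP; rewrite eqEcard cards2 eq_sym nzx max_cliqueD_le2 // andbT.
  by apply/subsetP=> y /set2P[] ->; rewrite inE ?x2 ?z2.
have in2 y : y \in K -> y != x -> y != z -> y \in L2.
  move=> yK yx yz; apply/negPn/negP=> y2; have : y \in K :\: L2 by rewrite inE yK y2.
  by rewrite eD2 !inE (negPf yx) (negPf yz).
have [y yK /andP[y1 nyx]] : exists2 y, y \in K & (y \notin L1) && (y != x).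
  have : 0 < #|K :\: L1 :\ x| by have := cardsD1 x (K :\: L1); rewrite inE xK x1 k1 /= add1n => -[<-].
  by case/card_gt0P=> y; rewrite !inE => /and3P[yx y1 yK]; exists y => //; rewrite y1.
have nyz : y != z by apply: contraNneq y1 => ->.
have eD1 : K :\: L1 = [set x; y].
  apply/esym/eqP; rewrite eqEcard cards2 eq_sym nyx max_cliqueD_le2 // andbT.
  by apply/subsetP=> t /set2P[] ->; rewrite inE ?x1 ?y1.
(* Otherwise [z] and the two vertices of [L1 :\: K] all lie in [L1 :\: L2]. *)
have [q qK /andP[q1 q2]] : exists2 q, q \notin K & (q \in L1) && (q \in L2).
  have [/subsetP sub|/subsetPn[q]] := boolP (L1 :\: K \subset L1 :\: L2); last first.
    rewrite !inE => /andP[qK q1]; rewrite q1 andbT negbK => q2.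
    by exists q; rewrite // q1.
  have := max_cliqueD_le2 m1 m2; have : z |: (L1 :\: K) \subset L1 :\: L2.
    by apply/subsetP=> t /setU1P[->|/sub//]; rewrite inE z1 z2.
  move/subset_leq_card; rewrite cardsU1 inE zK -(card_max_cliqueD mK m1) k1 /= => h1 h2.
  by have := leq_trans h1 h2.
have qcK k : k \in K -> k != x -> q -- k.
  move=> kK' nkx; have nqk : q != k by apply: contraNneq qK => ->.
  have [kz|nkz] := eqVneq k z; first by move/cliqueP: c1; apply=> //; rewrite kz.
  by move/cliqueP: c2; apply=> //; exact: in2.
pose L0 := q |: (K :\ x).
have m0 : max_clique L0.
  apply/max_cliqueP; split.
  - by move=> t /setU1P[->|/setD1P[_ /sK//]]; exact: s1.
  - apply: clique_setU1; first by apply: clique_subset cK; exact: subsetDl.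
    by move=> t /setD1P[tx tK]; exact: qcK.
  - by rewrite cardsU1 !inE (negPf qK) andbF -kK (cardsD1 x K) xK.
(* The clique [L0] loses only [q] to [K], only [y] to [L1] and only [z] to [L2]. If [L] missed two
   vertices of [L0], then [max_cliqueD_meet] with each of these cliques would make [L] miss all of
   [q], [y], [z]. *)
exists L0 => // L mL; rewrite leqNgt; apply/negP=> gt0.
have k0 : #|L0 :\: L| = 2 by apply/eqP; rewrite eqn_leq gt0 max_cliqueD_le2.
have q0 : q \in L0 by rewrite setU11.
have y0 : y \in L0 by rewrite !inE nyx yK orbT.
have z0 : z \in L0 by rewrite !inE nzx zK orbT.
have qL : q \notin L.
  have [|t] := max_cliqueD_meet m0 mL mK k0; first by apply/set0Pn; exists q; rewrite inE qK.
  by rewrite !inE => /orP[/eqP ->/andP[]//|/andP[_ ->]]; rewrite andbF.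
have yL : y \notin L.
  have [|t] := max_cliqueD_meet m0 mL m1 k0; first by apply/set0Pn; exists y; rewrite inE y1.
  rewrite in_setU1 => /orP[/eqP ->|/setD1P[tx tK]] /andP[tL t1]; first by rewrite q1 in t1.
  have : t \in K :\: L1 by rewrite inE tK t1.
  by rewrite eD1 !inE (negPf tx) => /eqP <-.
have zL : z \notin L.
  have [|t] := max_cliqueD_meet m0 mL m2 k0; first by apply/set0Pn; exists z; rewrite inE z2.
  rewrite in_setU1 => /orP[/eqP ->|/setD1P[tx tK]] /andP[tL t2]; first by rewrite q2 in t2.
  have : t \in K :\: L2 by rewrite inE tK t2.
  by rewrite eD2 !inE (negPf tx) => /eqP <-.
have sub : q |: [set y; z] \subset L0 :\: L.
  by apply/subsetP=> t /setU1P[->|/set2P[]->]; rewrite inE ?qL ?yL ?zL.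
have := subset_leq_card sub; rewrite k0 cardsU1 cards2 nyz !inE.
have nqK t : t \in K -> (q == t) = false by move=> tK; apply: contraNF qK => /eqP ->.
by rewrite !nqK.
Qed.

(** * Structure and colouring around a central clique *)

Section CentralClique.
Variable K : {set G}.
Hypotheses (mK : max_clique K) (w3 : 2 < w).
Hypothesis centralK : forall L, max_clique L -> #|K :\: L| <= 1.

Let sK : {subset K <= S}. Proof. by case/max_cliqueP: mK. Qed.
Let cK : {in K &, forall x y, x != y -> x -- y}.
Proof. by case/max_cliqueP: mK => _ /cliqueP. Qed.
Let kK : #|K| = w. Proof. by case/max_cliqueP: mK. Qed.

Definition misses_only e x :=
  [&& e \in S, e \notin K, x \in K, ~~ e -- x & [forall k in K, (k != x) ==> e -- k]].

Lemma misses_onlyP e x : reflect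
  [/\ e \in S, e \notin K, x \in K, ~~ e -- x & {in K, forall k, k != x -> e -- k}]
  (misses_only e x).
Proof.
apply: (iffP and5P) => -[eS eK xK nex h]; split=> //.
  by move=> k kK' nkx; move/forall_inP: h => /(_ k kK')/implyP; apply.
by apply/forall_inP=> k kK'; apply/implyP; exact: h.
Qed.

Lemma misses_only_inj e x y : misses_only e x -> misses_only e y -> x = y.
Proof.
move=> /misses_onlyP[_ _ _ _ h] /misses_onlyP[_ _ yK /negP ney _].
by apply/eqP/negPn/negP=> nxy; case: ney; apply: h => //; rewrite eq_sym.
Qed.

(** A [w]-clique avoiding [x] contains the rest of [K] by centrality, hence is K - x + e; maximality
    of [K] makes [e] miss [x]. *)
Lemma exists_misses_only x : x \in K -> exists e, misses_only e x.
Proof.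
move=> xK; have [L mL xL] := avoid (sK xK); have [sL /cliqueP cL _] := max_cliqueP _ mL.
have xD : x \in K :\: L by rewrite inE xK xL.
have inL k : k \in K -> k != x -> k \in L.
  move=> kK' nkx; apply/negPn/negP=> kL; have kD : k \in K :\: L by rewrite inE kK' kL.
  by have /card_le1P/(_ x xD k) := centralK mL; rewrite kD inE (negPf nkx).
have : 0 < #|L :\: K| by rewrite -(card_max_cliqueD mK mL) (cardsD1 x) xD.
case/card_gt0P=> e; rewrite inE => /andP[eK eL].
have adj k : k \in K -> k != x -> e -- k.
  by move=> kK' nkx; apply: cL => //; [exact: inL|apply: contraNneq eK => ->].
exists e; apply/misses_onlyP; split=> //; first exact: sL.
have [y yK] := max_clique_nonadj mK (sL e eL) eK.
by have [->//|nyx] := eqVneq y x; rewrite adj.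
Qed.

(** If [e] and [e'] were adjacent, adding them to K - x - x' would give a clique: too large if
    [x = x'], and otherwise a [w]-clique missing two vertices of [K]. *)
Lemma misses_only_stable e x e' x' : misses_only e x -> misses_only e' x' -> ~~ e -- e'.
Proof.
move=> /misses_onlyP[eS eK xK _ h] /misses_onlyP[e'S e'K x'K _ h']; apply/negP=> ee'.
pose L := e |: (e' |: (K :\ x :\ x')).
have cL : clique L.
  apply: clique_setU1 => [|y /setU1P[->//|]]; last by rewrite !inE => /and3P[_ ? ?]; exact: h.
  apply: clique_setU1 => [|y]; last by rewrite !inE => /and3P[? _ ?]; exact: h'.
  by apply/cliqueP=> y z; rewrite !inE => /and3P[_ _ yK] /and3P[_ _ zK]; exact: cK.
have sL : L \subset S.
  by apply/subsetP=> y; rewrite !inE => /or3P[/eqP->|/eqP->|/and3P[_ _ /sK]].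
have kL : #|L| = #|K :\ x :\ x'|.+2.
  by rewrite !cardsU1 !inE (negPf eK) (negPf e'K) !andbF orbF (adj_neq ee').
have kx : w = #|K :\ x|.+1 by rewrite -kK (cardsD1 x) xK.
have := cardsD1 x' (K :\ x); rewrite !inE x'K andbT => kx'.
have := cliques_le sL cL; rewrite kL kx kx'.
have [exx|nx] := eqVneq x' x; first by rewrite add0n ltnn.
move=> _; have mL : max_clique L.
  apply/max_cliqueP; split=> //; first exact/subsetP.
  by rewrite kL kx kx' nx.
have : [set x; x'] \subset K :\: L.
  apply/subsetP=> y; rewrite !inE => /orP[]/eqP->; rewrite ?xK ?x'K ?eqxx ?andbF ?orbF ?andbT.
    by rewrite negb_or !(contraTneq _ xK) // => ->.
  by rewrite negb_or !(contraTneq _ x'K) // => ->.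
by move/subset_leq_card; rewrite cards2 eq_sym nx => /leq_trans/(_ (centralK mL)).
Qed.

(* [K] together with [u], [v], [e], [e'] is covered by the three cliques {u, v},
   {e', x} and K - x + e, so it cannot be coloured with only the |K| colours of [K]. *)
Lemma outer_edge u v e e' x x' a b :
  u -- v -> u \notin K -> v \notin K -> misses_only e x -> misses_only e' x' -> x != x' ->
  u != e -> u != e' -> v != e -> v != e' ->
  a \in K -> b \in K -> a != b -> ~~ u -- a -> ~~ v -- b ->
  [|| (a == x) && (u -- e), (a == x') && (u -- e'), (b == x) && (v -- e)
    | (b == x') && (v -- e')].
Proof.
move=> uv uK vK mex mex' nxx' ue ue' ve ve' aK bK nab nua nvb; apply: contraT.
rewrite !negb_or !negb_and => /and4P[n1 n2 n3 n4].
have [_ eK xK nex adj] := misses_onlyP _ _ mex.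
have [_ e'K x'K ne'x' adj'] := misses_onlyP _ _ mex'.
have ee' : e != e' by apply: contra_neq nxx' => eq; apply: (misses_only_inj mex); rewrite eq.
have nuv := adj_neq uv.
pose H := u |: (v |: (e |: (e' |: K))).
have kH : #|H| = #|K|.+4.
  rewrite !cardsU1 !inE !negb_or /=.
  by rewrite uK vK eK e'K ue ue' ve ve' ee' nuv.
(* Each outer vertex takes the colour of a non-neighbour in [K]. Outer vertices can share a colour
   only when [a] or [b] is [x] or [x'], and the negated goal makes such pairs non-adjacent. *)
pose f y := if y == u then a else if y == v then b else if y == e then x
            else if y == e' then x' else y.
pose g y := if (y == u) || (y == v) then None
            else Some ((y == e') || (y == x)).
have nK t y : t \notin K -> y \in K -> (y == t) = false.
  by move=> tK yK; apply: contraNF tK => /eqP <-.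
have fu : f u = a by rewrite /f eqxx.
have fv : f v = b by rewrite /f eq_sym (negPf nuv) eqxx.
have fe : f e = x by rewrite /f !(eq_sym e) (negPf ue) (negPf ve) eqxx.
have fe' : f e' = x'.
  by rewrite /f (eq_sym e' u) (eq_sym e' v) (eq_sym e' e) (negPf ue') (negPf ve') (negPf ee') eqxx.
have fK y : y \in K -> f y = y by move=> yK; rewrite /f !nK.
have gu : g u = None by rewrite /g eqxx.
have gv : g v = None by rewrite /g eqxx orbT.
have ge : g e = Some false.
  rewrite /g (eq_sym e u) (negPf ue) (eq_sym e v) (negPf ve) (negPf ee') (eq_sym e x).
  by rewrite nK.
have ge' : g e' = Some true by rewrite /g !(eq_sym e') (negPf ue') (negPf ve') eqxx.
have gx : g x = Some true by rewrite /g eqxx orbT !nK.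
have gK y : y \in K -> y != x -> g y = Some false.
  by move=> yK /negPf nyx; rewrite /g (nK u) // (nK v) // (nK e') // nyx.
have mem y : y \in H -> y = u \/ y = v \/ y = e \/ y = e' \/ y \in K.
  by rewrite !inE => /or4P[/eqP|/eqP|/eqP|/orP[/eqP|]]; tauto.
have : #|H| <= #|K| + #|[set: option bool]|.
  apply: (@hng_card _ _ _ _ f g) => [y /mem|//|y z /mem hy /mem hz yz|y z /mem hy /mem hz nyz].
  - by case=> [->|[->|[->|[->|yK]]]]; rewrite ?fu ?fv ?fe ?fe' ?(fK _ yK).
  - have Nuv : a = b -> ~~ u -- v by move/eqP; rewrite (negPf nab).
    have Nee' : x = x' -> ~~ e -- e' by move/eqP; rewrite (negPf nxx').
    have Nue : a = x -> ~~ u -- e by move=> eq; rewrite eq eqxx in n1.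
    have Nue' : a = x' -> ~~ u -- e' by move=> eq; rewrite eq eqxx in n2.
    have Nve : b = x -> ~~ v -- e by move=> eq; rewrite eq eqxx in n3.
    have Nve' : b = x' -> ~~ v -- e' by move=> eq; rewrite eq eqxx in n4.
    have NuK k : a = k -> ~~ u -- k by move=> <-.
    have NvK k : b = k -> ~~ v -- k by move=> <-.
    have NeK k : x = k -> ~~ e -- k by move=> <-.
    have Ne'K k : x' = k -> ~~ e' -- k by move=> <-.
    apply: contraTneq yz.
    case: hy => [->|[->|[->|[->|yK]]]]; case: hz => [->|[->|[->|[->|zK]]]];
      rewrite ?fu ?fv ?fe ?fe' ?(fK _ yK) ?(fK _ zK) => eq;
      first [by rewrite sedge_irrefl|by auto|by rewrite eq sedge_irrefl
            |by rewrite adjC; move/esym: eq => eq; auto].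
  - have mem' t : t = u \/ t = v \/ t = e \/ t = e' \/ t \in K ->
        t = u \/ t = v \/ t = e \/ t = e' \/ t = x \/ (t \in K /\ t != x).
      by have [->|ntx] := eqVneq t x; intuition auto.
    have e'x : e' -- x by apply: adj'.
    case: (mem' _ hy) nyz => [->|[->|[->|[->|[->|[yK nyx]]]]]];
    case: (mem' _ hz) => [->|[->|[->|[->|[->|[zK nzx]]]]]];
      rewrite ?gu ?gv ?ge ?ge' ?gx ?(gK _ yK nyx) ?(gK _ zK nzx) ?eqxx // => nyz _;
      by [auto|rewrite adjC; auto].
by rewrite kH cardsT card_option card_bool -addn4 leq_add2l.
Qed.

(** The set E. *)
Let missing v := [exists x, misses_only v x].

Lemma two_nonadj v : v \in S -> v \notin K -> ~~ missing v ->
  exists a b, [/\ a \in K, b \in K, a != b, ~~ v -- a & ~~ v -- b].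
Proof.
move=> vS vK /existsPn miss; have [a aK nva] := max_clique_nonadj mK vS vK.
have := miss a; rewrite /misses_only vS vK aK nva /=.
rewrite negb_forall_in => /exists_inP[b bK]; rewrite negb_imply eq_sym => /andP[nab nvb].
by exists a, b.
Qed.

(** Apply [outer_edge] to an edge inside R and two vertices of E missing different vertices of [K]:
    each alternative is an edge between R and E. *)
Lemma remainder_stable v v' :
  v \in S -> v \notin K -> ~~ missing v -> {in missing, forall e, ~~ v -- e} ->
  v' \in S -> v' \notin K -> ~~ missing v' -> {in missing, forall e, ~~ v' -- e} ->
  ~~ v -- v'.
Proof.
move=> vS vK mv nv v'S v'K mv' nv'; apply/negP=> vv'.
have [a [_ [aK _ _ nva _]]] := two_nonadj vS vK mv.
have [b [bK nab nvb]] : exists b, [/\ b \in K, a != b & ~~ v' -- b].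
  have [b [b' [bK b'K nbb' nvb nvb']]] := two_nonadj v'S v'K mv'.
  by have [eab|nab] := eqVneq a b; [exists b'|exists b]; split=> //; rewrite eab.
have [|x xK _] := @exists_notin _ K [::]; first by rewrite kK ltnW // ltnW.
have [|x' x'K] := @exists_notin _ K [:: x]; first by rewrite kK ltnW.
rewrite inE eq_sym => nxx'.
have [e mex] := exists_misses_only xK; have [e' mex'] := exists_misses_only x'K.
have me : missing e by apply/existsP; exists x.
have me' : missing e' by apply/existsP; exists x'.
have neq t s : ~~ missing t -> missing s -> t != s.
  by move=> mt ms; apply: contraNneq mt => ->.
have := outer_edge vv' vK v'K mex mex' nxx' (neq _ _ mv me) (neq _ _ mv me')
  (neq _ _ mv' me) (neq _ _ mv' me') aK bK nab nva nvb.
by rewrite !(negPf (nv _ _)) // !(negPf (nv' _ _)) // !andbF.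
Qed.

(** Both claims apply [outer_edge] to the edge from [f] to [e], with non-neighbours [a] and [x]. If
    [w] exceeds 3, two vertices of E missing neither [a] nor [x] refute every alternative; if one of
    the two misses [a], the only alternative left is that [f] is adjacent to it. *)
Lemma attached_nonadj f e x a :
  f \in S -> f \notin K -> ~~ missing f -> misses_only e x -> f -- e ->
  a \in K -> a != x -> ~~ f -- a -> w = 3 /\ forall e', misses_only e' a -> f -- e'.
Proof.
move=> fS fK mf mex fe aK nax nfa.
have [eS eK xK nex _] := misses_onlyP _ _ mex.
have neqf t y : misses_only t y -> f != t.
  by move=> mt; apply: contraNneq mf => ->; apply/existsP; exists y.
have neqe t y : misses_only t y -> y != x -> e != t.
  by move=> mt; apply: contra_neq => eq; apply: misses_only_inj mt _; rewrite -eq.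
split.
  apply/eqP; rewrite eqn_leq w3 andbT leqNgt; apply/negP=> w4.
  have [|y yK] := @exists_notin _ K [:: a; x]; first by rewrite kK ltnW.
  rewrite !inE negb_or => /andP[nya nyx].
  have [|z zK] := @exists_notin _ K [:: a; x; y]; first by rewrite kK.
  rewrite !inE !negb_or => /and3P[nza nzx nzy].
  have [s ms] := exists_misses_only yK; have [t mt] := exists_misses_only zK.
  have nyz : y != z by rewrite eq_sym.
  have := outer_edge fe fK eK ms mt nyz (neqf _ _ ms) (neqf _ _ mt) (neqe _ _ ms nyx)
    (neqe _ _ mt nzx) aK xK nax nfa nex.
  by rewrite !(eq_sym a) !(eq_sym x) (negPf nya) (negPf nyx) (negPf nza) (negPf nzx).
move=> t mt; have [|y yK] := @exists_notin _ K [:: a; x]; first by rewrite kK.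
rewrite !inE negb_or => /andP[nya nyx]; have [s ms] := exists_misses_only yK.
have nay : a != y by rewrite eq_sym.
have := outer_edge fe fK eK mt ms nay (neqf _ _ mt) (neqf _ _ ms) (neqe _ _ mt nax)
    (neqe _ _ ms nyx) aK xK nax nfa nex.
by rewrite eqxx (negPf nay) (eq_sym x a) (negPf nax) (eq_sym x) (negPf nyx) /= orbF.
Qed.

(** For [w = 3] a triangle is a maximum clique, so centrality applies to it. *)
Lemma no_remote_triangle p q r : w = 3 -> p \in S -> q \in S -> r \in S ->
  p -- q -> p -- r -> q -- r -> 1 < #|K :\: (p |: [set q; r])| -> False.
Proof.
move=> ew pS qS rS pq pr qr; rewrite ltnNge centralK //.
apply/max_cliqueP; split; last by rewrite card_clique3.
  by move=> t /setU1P[->|/set2P[]->].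
exact: clique3.
Qed.

(** The set F. *)
Let attached f := [&& f \in S, f \notin K, ~~ missing f & [exists e, missing e && (f -- e)]].

(** Let [f] miss [a] and [b] in [K], with [a] other than [x]. Then [f] is adjacent to some [t]
    missing only [a], and an edge from [f] to [k] would close a triangle [f], [k], [t] avoiding both
    [a] and [b]. *)
Lemma attached_anticomplete f k : attached f -> k \in K -> ~~ f -- k.
Proof.
case/and4P=> fS fK mf /existsP[e /andP[/existsP[x mex] fe]] kK'; apply/negP=> fk.
have [a [b [aK bK nab nfa nfb]]] := two_nonadj fS fK mf.
wlog nax : a b aK bK nab nfa nfb / a != x.
  move=> th; have [eax|nax] := eqVneq a x; last exact: (th a b).
  by apply: (th b a) => //; rewrite 1?eq_sym // -eax.
have [ew adj] := attached_nonadj fS fK mf mex fe aK nax nfa.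
have [t mt] := exists_misses_only aK; have [tS tK _ _ ht] := misses_onlyP _ _ mt.
have nka : k != a by apply: contraNneq nfa => <-.
have nkb : k != b by apply: contraNneq nfb => <-.
apply: (no_remote_triangle ew fS (sK kK') tS fk (adj t mt)); first by rewrite adjC ht.
have : [set a; b] \subset K :\: (f |: [set k; t]).
  have nK s y : s \notin K -> y \in K -> (y == s) = false.
    by move=> sK' yK; apply: contraNF sK' => /eqP <-.
  by apply/subsetP=> y /set2P[]->; rewrite !inE (nK f) // (nK t) // ?aK ?bK orbF andbT eq_sym.
by move/subset_leq_card; rewrite cards2 nab.
Qed.

(** Some [a] in [K] differs from [x] and [x']; both [f] and [f'] are adjacent to a vertex [t]
    missing [a], so an edge between them would give a triangle disjoint from [K]. *)
Lemma attached_stable f f' : attached f -> attached f' -> ~~ f -- f'.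
Proof.
move=> af af'; apply/negP=> ff'.
have [fS fK mf /existsP[e /andP[/existsP[x mex] fe]]] := and4P af.
have [f'S f'K mf' /existsP[e' /andP[/existsP[x' mex'] f'e']]] := and4P af'.
have [|a aK] := @exists_notin _ K [:: x; x']; first by rewrite kK.
rewrite !inE negb_or => /andP[nax nax'].
have [ew adj] := attached_nonadj fS fK mf mex fe aK nax (attached_anticomplete af aK).
have [_ adj'] := attached_nonadj f'S f'K mf' mex' f'e' aK nax' (attached_anticomplete af' aK).
have [t mt] := exists_misses_only aK; have [tS tK _ _ _] := misses_onlyP _ _ mt.
apply: (no_remote_triangle ew fS f'S tS ff' (adj t mt) (adj' t mt)).
rewrite (_ : K :\: _ = K) ?kK 1?ltnW //; apply/setP=> y; rewrite !inE.
by case yK: (y \in K); rewrite ?andbF // andbT !negb_or !(contraTneq _ yK) // => ->.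
Qed.

Lemma central_colorable : colorable_on S w.+1.
Proof.
(* The clique [K] uses the colours below [w], F reuses 0 since it is anticomplete to [K], and E + R
   takes [w]. *)
exists (fun v => if v \in K then index v (enum K) else if attached v then 0 else w).
have idx v : v \in K -> index v (enum K) < w by move=> vK; rewrite -kK cardE index_mem mem_enum.
split=> [v vS|u v uS vS uv].
  by case: ifPn => [/idx/ltnW//|_]; case: ifP.
have w0 : 0 < w by rewrite (ltn_trans _ w3).
have rest t : t \in S -> t \notin K -> ~~ attached t -> missing t \/
    ~~ missing t /\ {in missing, forall e, ~~ t -- e}.
  move=> tS tK; rewrite /attached tS tK /=; have [|mt] := boolP (missing t); first by left.
  by move/existsPn=> h; right; split=> // e me; move: (h e); rewrite (_ : missing e).
have [uK|uK] := boolP (u \in K); have [vK|vK] := boolP (v \in K).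
- apply: contraTneq uv => /(congr1 (nth u (enum K))).
  by rewrite !nth_index ?mem_enum // => ->; rewrite sedge_irrefl.
- case: ifPn => [av|_]; last by rewrite neq_ltn idx.
  by have := attached_anticomplete av uK; rewrite adjC uv.
- case: ifPn => [au|_]; last by rewrite neq_ltn idx // orbT.
  by have := attached_anticomplete au vK; rewrite uv.
- case: ifPn => au; case: ifPn => av; rewrite ?neq_ltn ?w0 ?orbT //.
    by have := attached_stable au av; rewrite uv.
  case: (rest u uS uK au) (rest v vS vK av) => [mu|[mu nu]] [mv|[mv nv]].
  + have [[x mx] [y my]] := (existsP mu, existsP mv).
    by have := misses_only_stable mx my; rewrite uv.
  + by have := nv u mu; rewrite adjC uv.
  + by have := nu v mv; rewrite uv.
  + by have := remainder_stable uS uK mu nu vS vK mv nv; rewrite uv.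
Qed.

End CentralClique.

Lemma avoiding_colorable : 2 < w -> colorable_on S w.+1.
Proof.
move=> w3; have [S0|S0] := eqVneq S set0.
  by exists (fun=> 0); rewrite S0; split=> x; rewrite inE.
by have [K mK cK] := exists_central_max_clique w3 S0; exact: central_colorable cK.
Qed.

End BoundedCliques.

(** * The triangle-free case *)

Lemma triangle_free_colorable S :
  (forall K, K \subset S -> clique K -> #|K| <= 2) ->
  {in S, forall v, colorable_on (S :\ v) 3} -> colorable_on S 3.
Proof.
move=> cl2 IH.
have tf x y z : x \in S -> y \in S -> z \in S -> x -- y -> x -- z -> ~~ y -- z.
  move=> xS yS zS xy xz; apply/negP=> yz; have := cl2 (x |: [set y; z]).
  rewrite card_clique3 // => H; suff: false by []; apply: H; last exact: clique3.
  by apply/subsetP=> t /setU1P[->|/set2P[]->].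
(* A vertex with at most one neighbour [y] gets the colour [f y == 0], read as 0 or 1, which always
   differs from [f y]. *)
have pendant x y : x \in S -> {in S, forall z, x -- z -> z = y} -> colorable_on S 3.
  move=> xS xy; have [f [f3 fP]] := IH x xS.
  have memD z : z \in S -> z != x -> z \in S :\ x by rewrite !inE => -> ->.
  have fy z : z \in S -> x -- z -> (f y == 0 : nat) != f z.
    by move=> zS /xy ->//; case: (f y).
  exists (fun z => if z == x then (f y == 0 : nat) else f z); split=> [z zS|u v uS vS uv].
    by case: eqVneq => [_|nzx]; [case: eqP|exact/f3/memD].
  case: (eqVneq u x) uv => [->|nux]; case: (eqVneq v x) => [->|nvx]; rewrite ?sedge_irrefl //.
  - exact: fy.
  - by rewrite adjC eq_sym; exact: fy.
  - by apply: fP; exact: memD.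
have [|/existsPn noedge] := boolP [exists x, [exists y, [&& x \in S, y \in S & x -- y]]]; last first.
  exists (fun=> 0); split=> // x y xS yS xy.
  by have /existsPn/(_ y) := noedge x; rewrite xS yS xy.
case/existsP=> x /existsP[y /and3P[xS yS xy]].
have [|/existsPn A0] := boolP [exists a, [&& a \in S, x -- a & a != y]]; last first.
  apply: (pendant x y) => // z zS xz; apply/eqP/negPn/negP=> nzy.
  by have := A0 z; rewrite zS xz nzy.
case/existsP=> a /and3P[aS xa nay].
have [|/existsPn B0] := boolP [exists b, [&& b \in S, y -- b & b != x]]; last first.
  apply: (pendant y x) => // z zS yz; apply/eqP/negPn/negP=> nzx.
  by have := B0 z; rewrite zS yz nzx.
case/existsP=> b /and3P[bS yb nbx].
pose R := [set r in S | ~~ x -- r & ~~ y -- r].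
have RP r : r \in R -> [/\ r \in S, ~~ x -- r & ~~ y -- r] by rewrite inE => /and3P.
have [|/existsPn R0] := boolP [exists r, [exists r', [&& r \in R, r' \in R & r -- r']]]; last first.
  (* If [R] is stable, the neighbours of [x], those of [y], and [R] are three stable classes. *)
  exists (fun v => if x -- v then 0 else if y -- v then 1 else 2).
  split=> [v _|u v uS vS uv]; first by do 2?case: ifP.
  have [xu|xu] := boolP (x -- u); have [xv|xv] := boolP (x -- v); do ?by case: ifP.
    by have := tf x u v xS uS vS xu xv; rewrite uv.
  have [yu|yu] := boolP (y -- u); have [yv|yv] := boolP (y -- v) => //.
    by have := tf y u v yS uS vS yu yv; rewrite uv.
  by have /existsPn/(_ v) := R0 u; rewrite !inE uS vS xu xv yu yv uv.
case/existsP=> r0 /existsP[r0' /and3P[r0R r0'R r0r0']].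
(* Otherwise {x, a'}, {y, b'}, {r, r'} is a perfect matching of a bipartite graph. *)
have dom a' b' r r' : a' \in S -> b' \in S -> r \in R -> r' \in R -> x -- a' -> y -- b' ->
    a' != y -> b' != x -> r -- r' -> (r -- a') && (r -- b') || (r' -- a') && (r' -- b').
  move=> a'S b'S rR r'R xa' yb' na'y nb'x rr'.
  have [rS nxr nyr] := RP r rR; have [r'S nxr' nyr'] := RP r' r'R.
  apply: contraT; rewrite negb_or !negb_and => /andP[n1 n2].
  have nya' : ~~ y -- a' by apply: (tf x).
  have nxb' : ~~ x -- b' by apply: (tf y) => //; rewrite adjC.
  have nab' : a' != b' by apply: contraTneq xa' => ->.
  have Rneq s t : s \in R -> (x -- t) || (y -- t) -> s != t.
    by move=> /RP[_ nxs nys]; apply: contraTneq => <-; rewrite negb_or nxs.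
  have yx : y -- x by rewrite adjC.
  have nxa' := adj_neq xa'; have nyb' := adj_neq yb'; have nxy := adj_neq xy.
  have nrr' := adj_neq rr'.
  have [rx ry ra rb] : [/\ r != x, r != y, r != a' & r != b'].
    by split; apply: Rneq; rewrite ?xy ?yx ?xa' ?yb' ?orbT.
  have [r'x r'y r'a r'b] : [/\ r' != x, r' != y, r' != a' & r' != b'].
    by split; apply: Rneq; rewrite ?xy ?yx ?xa' ?yb' ?orbT.
  (* The two colour classes are {x, b'} for [true] and {y, a'} for [false]; [t] is the class that
     [r] joins, and [r'] joins the other. With three cliques in the cover, six vertices exceed 2 +
     3. *)
  pose t := (r -- a') || (r' -- b').
  pose H := r |: (r' |: (a' |: (b' |: [set x; y]))).
  have kH : #|H| = 6.
    rewrite !cardsU1 cards1 !inE !negb_or nrr' nab' nxy rx ry ra rb r'x r'y r'a r'b.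
    by rewrite na'y nb'x (eq_sym a' x) nxa' (eq_sym b' y) nyb'.
  pose f v := if v == r then t else if v == r' then ~~ t else (v == x) || (v == b').
  pose g v := if (v == r) || (v == r') then None else Some ((v == x) || (v == a')).
  have mem v : v \in H -> v = r \/ v = r' \/ v = a' \/ v = b' \/ v = x \/ v = y.
    by rewrite !inE => /or4P[/eqP|/eqP|/eqP|/or3P[/eqP|/eqP|/eqP]]; tauto.
  have fr : f r = t by rewrite /f eqxx.
  have fr' : f r' = ~~ t by rewrite /f eq_sym (negPf nrr') eqxx.
  have nr s : r != s -> (s == r) = false by move=> ?; rewrite eq_sym; exact: negPf.
  have nr' s : r' != s -> (s == r') = false by move=> ?; rewrite eq_sym; exact: negPf.
  have [fx fb fy fa] : [/\ f x = true, f b' = true, f y = false & f a' = false].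
    rewrite /f !nr ?nr' // !eqxx orbT (negPf nab') (eq_sym y x) (negPf nxy) (negPf nyb').
    by rewrite (eq_sym a' x) (negPf nxa').
  have [gr gr'] : g r = None /\ g r' = None by rewrite /g !eqxx orbT.
  have [gx gb gy ga] : [/\ g x = Some true, g b' = Some false, g y = Some false & g a' = Some true].
    rewrite /g !nr ?nr' //= !eqxx orbT (negPf nb'x) (eq_sym b' a') (negPf nab').
    by rewrite (eq_sym y x) (negPf nxy) (eq_sym y a') (negPf na'y).
  have [ar ar'] : (false = t -> ~~ a' -- r) /\ (false = ~~ t -> ~~ a' -- r').
    rewrite /t; split=> [|/esym/negbFE/orP[ra'|r'b']].
    - by rewrite (adjC a' r); case: (r -- a').
    - by apply: (tf r).
    - by rewrite (adjC a' r'); move: n2; rewrite r'b' orbF.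
  have [br br'] : (true = t -> ~~ b' -- r) /\ (true = ~~ t -> ~~ b' -- r').
    rewrite /t; split=> [/esym/orP[ra'|r'b']|].
    - by rewrite (adjC b' r); move: n1; rewrite ra'.
    - by apply: (tf r') => //; rewrite adjC.
    - by rewrite negb_or (adjC b' r') => /esym/andP[].
  have [tn nt] : t <> ~~ t /\ ~~ t <> t by case: (t).
  have : #|H| <= #|[set: bool]| + #|[set: option bool]|.
    apply: (@hng_card _ _ _ _ f g) => // u v /mem hu /mem hv.
      move=> uv; apply: contraTneq uv.
      case: hu => [->|[->|[->|[->|[->|->]]]]]; case: hv => [->|[->|[->|[->|[->|->]]]]];
      rewrite ?fr ?fr' ?fx ?fb ?fy ?fa // => eq;
      first [by rewrite sedge_irrefl|by auto|by rewrite adjC; auto|by case: tn|by case: nt].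
    case: hu => [->|[->|[->|[->|[->|->]]]]]; case: hv => [->|[->|[->|[->|[->|->]]]]];
    rewrite ?gr ?gr' ?gx ?gb ?gy ?ga ?eqxx // => _ _; by [auto|rewrite adjC; auto].
  by rewrite kH !cardsT card_option card_bool.
(* By [dom], a neighbour of [x] and a neighbour of [y] are both adjacent to [r0] or both to [r0'],
   so an edge between them would close a triangle. *)
have nbr_stable u v : u \in S -> v \in S -> u != x -> u != y -> v != x -> v != y ->
    (x -- u) || (y -- u) -> (x -- v) || (y -- v) -> ~~ u -- v.
  have [[r0S _ _] [r0'S _ _]] := (RP _ r0R, RP _ r0'R).
  have cross s t : s \in S -> t \in S -> s != y -> t != x -> x -- s -> y -- t -> ~~ s -- t.
    move=> sS tS nsy ntx xs yt.
    by case/orP: (dom s t r0 r0' sS tS r0R r0'R xs yt nsy ntx r0r0') => /andP[? ?];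
       [exact: (tf r0)|exact: (tf r0')].
  move=> uS vS ux uy vx vy /orP[xu|yu] /orP[xv|yv].
  - exact: (tf x).
  - exact: cross.
  - by rewrite adjC; exact: cross.
  - exact: (tf y).
(* By [dom] and triangle-freeness, each edge inside [R] has exactly one end adjacent to [a], so
   adjacency to [a] splits [R] into two stable sets. *)
exists (fun v => if v == x then 1 else if v == y then 2 else
                 if (x -- v) || (y -- v) then 0 else if a -- v then 1 else 2).
split=> [v _|u v uS vS uv]; first by do 4?case: ifP.
case: (eqVneq u x) uv => [->|ux] uv.
  by rewrite uv (eq_sym v x) (negPf (adj_neq uv)) /=; case: ifP.
case: (eqVneq v x) uv => [->|vx] uv.
  by rewrite adjC in uv; rewrite uv /=; case: ifP.
case: (eqVneq u y) uv => [->|uy] uv.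
  by rewrite uv orbT (eq_sym v y) (negPf (adj_neq uv)).
case: (eqVneq v y) uv => [->|vy] uv.
  by rewrite adjC in uv; rewrite uv orbT.
have [hu|hu] := boolP ((x -- u) || (y -- u)); have [hv|hv] := boolP ((x -- v) || (y -- v)).
- by have := nbr_stable u v uS vS ux uy vx vy hu hv; rewrite uv.
- by case: ifP.
- by case: ifP.
move: hu hv; rewrite !negb_or => hu hv.
have uR : u \in R by rewrite inE uS.
have vR : v \in R by rewrite inE vS.
have := dom a b u v aS bS uR vR xa yb nay nbx uv.
case au: (a -- u); case av: (a -- v) => //.
  by have := tf a u v aS uS vS au av; rewrite uv.
by rewrite !(adjC _ a) au av.
Qed.

(** * The induction on vertex sets *)

Lemma colorable_of_cliques_le w S :
  (forall K, K \subset S -> clique K -> #|K| <= w) -> colorable_on S w.+1.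
Proof.
have [n] := ubnP #|S|; elim: n => // n IH in w S * => /ltnSE leSn cl.
have ltS v : v \in S -> #|S :\ v| < n.
  by move=> vS; apply: leq_trans leSn; rewrite [X in _ < X](cardsD1 v) vS.
have [avoid|] := boolP [forall v in S, [exists L, max_clique S w L && (v \notin L)]]; last first.
  rewrite negb_forall_in => /exists_inP[v vS /existsPn noL].
  have w0 : 0 < w by rewrite -(cards1 v) cl ?sub1set // clique1.
  (* Every [w]-clique contains [v] (perhaps there is none), so the bound drops to [w.-1] on
     [S :\ v]; the colours below [w] suffice there and [v] takes [w]. *)
  have [|f [fw fP]] := IH w.-1 (S :\ v) (ltS v vS).
    move=> K; rewrite subsetD1 => /andP[KS vK] cK.
    rewrite -ltnS prednK // ltn_neqAle cl // andbT.
    by apply: contraNneq (noL K) => kK; rewrite /max_clique KS cK kK eqxx.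
  rewrite prednK // in fw; have memD z : z \in S -> z != v -> z \in S :\ v.
    by rewrite !inE => -> ->.
  exists (fun z => if z == v then w else f z); split=> [z zS|a b aS bS ab].
    by case: (eqVneq z v) => // nzv; rewrite ltnW // ltnS fw // memD.
  case: (eqVneq a v) ab => [->|nav]; case: (eqVneq b v) => [->|nbv]; rewrite ?sedge_irrefl // => ab.
  - by rewrite neq_ltn fw ?memD ?orbT.
  - by rewrite neq_ltn fw ?memD.
  - by apply: fP; rewrite ?memD.
have {}avoid : {in S, forall v, exists2 L, max_clique S w L & v \notin L}.
  by move=> v vS; have /existsP[L /andP[]] := forall_inP avoid v vS; exists L.
have [w3|] := ltnP 2 w; first exact: avoiding_colorable cl avoid w3.
rewrite leq_eqVlt => /orP[/eqP w2|w1].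
  rewrite w2 in cl *; apply: triangle_free_colorable => // v vS.
  apply: (IH 2) => [|K]; first exact: ltS.
  by rewrite subsetD1 => /andP[KS _]; exact: cl.
exists (fun=> 0); split=> // x y xS yS xy.
have := cl [set x; y]; rewrite cards2 (adj_neq xy) clique2 // => h.
suff: 1 < 1 by []; apply: leq_trans (w1 : w <= 1); apply: h => //.
by apply/subsetP=> z /set2P[]->.
Qed.
End OneHNG.

Theorem theorem4p2 (G : sgraph) (G_nonempty : 0 < #|G|) (G_HNG : one_HNG G) :
  chromatic_number G <= clique_number G + 1.
Proof.
have [K _ cK|f [fw fP]] := colorable_of_cliques_le G_HNG (w := clique_number G) (S := setT).
  by rewrite /clique_number (leq_bigmax_cond _ cK).
by rewrite addn1; apply: (@chromatic_number_le _ _ f) => [x|x y]; [exact: fw|exact: fP].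
Qed.
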